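(* Let $Y$ be a binary random variable with values in $\{0,1\}$, let $X$ be a random variable with distribution function $F_X$, and let $\mu=\Pr(Y=1)\in(0,1)$ and $\mu(x)=\Pr(Y=1\mid X=x)$. Suppose that the copula density of $(X,Y)$ is given by the LP log-bilinear model with coefficients $\theta_{j1}$, $j\ge1$, which for binary $Y$ reads $$c_{\theta}(u,v;X,Y)=\frac1{Z_\theta}\exp\Bigl\{\sum_{j}\theta_{j1}\,S_j(u;X)\,S_1(v;Y)\Bigr\},\qquad (u,v)\in(0,1)^2 .$$ Then the log-odds satisfy, for (almost every) value $x$ of $X$, $$\operatorname{logit}\{\mu(x)\}=\log\left(\frac{\mu(x)}{1-\mu(x)}\right)=\alpha_0+\sum_j\alpha_j\,T_j(x;F_X),$$ where $\alpha_0=\operatorname{logit}(\mu)=\log\frac{\mu}{1-\mu}$ and $\alpha_j=\dfrac{\theta_{j1}}{\sqrt{\mu(1-\mu)}}$.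
   Context: LP-basis: for a non-degenerate random variable $X$ (discrete or continuous) with distribution function $F_X$ and probability mass function $p(x;F_X)=\Pr(X=x)$ (identically $0$ if $X$ is continuous), put $F^{\mathrm{mid}}(x;F_X)=F_X(x)-\tfrac12p(x;F_X)$ and $$T_1(x;F_X)=\frac{\sqrt{12}\,\{F^{\mathrm{mid}}(x;F_X)-1/2\}}{\sqrt{1-\sum_xp^3(x;F_X)}}.$$ The functions $T_2,T_3,\dots$ are obtained by Gram–Schmidt orthonormalization, in $L^2(F_X)$, of $T_1^2,T_1^3,\dots$ (after $1$ and $T_1$), so that $\int T_j\,dF_X=0$ and $\int T_jT_k\,dF_X=\delta_{jk}$. With $Q_X$ the quantile function, $S_j(u;X)=T_j(Q_X(u);F_X)$ for $0<u<1$, and similarly for $Y$. For binary $Y$ there is only one LP-basis function, $T_1(y;F_Y)=\frac{y-\mu}{\sqrt{\mu(1-\mu)}}$, $y\in\{0,1\}$. Copula density: $c_{X,Y}(u,v)$ on $(0,1)^2$ is the density of the joint law of $(X,Y)$ with respect to the product of the marginal laws, evaluated at $(Q_X(u),Q_Y(v))$. Thus for (almost every) $x$ and $y\in\{0,1\}$ its value at the point corresponding to $(x,y)$ is $\frac{\Pr(Y=y\mid X=x)}{\Pr(Y=y)}$. The hypothesis that the copula density is given by the model therefore means $$\frac{\Pr(Y=y\mid X=x)}{\Pr(Y=y)}=\frac1{Z_\theta}\exp\Bigl\{\sum_j\theta_{j1}T_j(x;F_X)\,T_1(y;F_Y)\Bigr\},\qquad y\in\{0,1\}.$$ Here $Z_\theta\in(0,\infty)$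 is the constant making $c_\theta$ integrate to $1$ over $[0,1]^2$. The sum over $j\ge1$ is finite, or is a series assumed to converge for (almost every) value $x$. *)

(* Defs.v *)
From HB Require Import structures.
From mathcomp Require Import all_boot all_order all_algebra.
From mathcomp Require Import all_classical all_reals all_analysis.
Set Implicit Arguments.
Unset Strict Implicit.
Unset Printing Implicit Defensive.
Import Order.TTheory GRing.Theory Num.Theory.
Import numFieldNormedType.Exports.
Local Open Scope classical_set_scope.
Local Open Scope ring_scope.

Definition logit (R : realType) (p : R) : R := ln (p / (1 - p)).

Section LPBasis.
Context (d : measure_display) (T : measurableType d) (R : realType).
Context (P : probability T R).
Implicit Types X Y : {RV P >-> R}.

Definition nondegenerate_rv X : Prop :=
  forall a : R, P (X @^-1` [set a]) <> 1%E.

Definition discrete_rv X : Prop :=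
  exists2 A : set R, countable A & P (X @^-1` A) = 1%E.

Definition continuous_rv X : Prop :=
  forall a : R, P (X @^-1` [set a]) = 0%E.

Definition Fmid X (x : R) : R := fine (cdf X x) - 2^-1 * pmf X x.

Definition LP_T1 X (x : R) : R :=
  Num.sqrt 12 * (Fmid X x - 2^-1) /
  Num.sqrt (1 - fine (\esum_(a in [set: R]) (pmf X a ^+ 3)%:E)).

(* Inner product of L^2(F_X). *)
Definition L2dot X (f g : R -> R) : R :=
  \int[distribution P X]_x (f x * g x).

(* One Gram-Schmidt step. When the residual is null in L^2(F_X), as happens
   for every power beyond the last independent one when X has finitely many
   values, the division by 0 returns the zero function: there is no further
   basis function. *)
Definition gram_schmidt_step X (s : seq (R -> R)) (f : R -> R) : R -> R :=
  let r := fun x => f x - \sum_(g <- s) L2dot X f g * g x in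
  fun x => r x / Num.sqrt (L2dot X r r).

(* [:: T_0; ...; T_n], with T_0 the constant function 1. *)
Fixpoint LP_family X (n : nat) : seq (R -> R) :=
  match n with
  | 0%N => [:: fun=> 1]
  | m.+1 =>
      let s := LP_family X m in
      rcons s (if m is 0%N then LP_T1 X
               else gram_schmidt_step X s (fun x => LP_T1 X x ^+ n))
  end.

Definition LP_T X (j : nat) : R -> R := last (fun=> 1) (LP_family X j).

Definition quantile X (u : R) : R := inf [set x | (u%:E <= cdf X x)%E].

Definition LP_S X (j : nat) (u : R) : R := LP_T X j (quantile X u).

Definition unit_square : set (R * R) := `]0, 1[ `*` `]0, 1[.

(* The (ordered) infinite sum over j >= 1 covers finite sums, i.e. theta with
   finite support; theta j stands for the coefficient indexed by (j, 1). *)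
Definition LP_exponent X Y (theta : nat -> R) (u v : R) : R :=
  \big[+%R/0]_(1 <= j <oo) (theta j * LP_S X j u * LP_S Y 1 v).

Definition LP_Z X Y (theta : nat -> R) : \bar R :=
  (\int[lebesgue_measure \x lebesgue_measure]_(w in unit_square)
     (expR (LP_exponent X Y theta w.1 w.2))%:E)%E.

Definition LP_model X Y (theta : nat -> R) (u v : R) : R :=
  (fine (LP_Z X Y theta))^-1 * expR (LP_exponent X Y theta u v).

(* f is a version of the density of the joint law of (X, Y) with respect to
   the product of the marginal laws. *)
Definition is_joint_density X Y (f : R * R -> R) : Prop :=
  [/\ measurable_fun [set: R * R] f,
      forall z, 0 <= f z &
      forall A : set (R * R), measurable A ->
        P [set w | A (X w, Y w)] =
        (\int[distribution P X \x distribution P Y]_(z in A) (f z)%:E)%E].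

Definition copula_density X Y (f : R * R -> R) (u v : R) : R :=
  f (quantile X u, quantile Y v).

(* Densities being defined only up to null sets, "the copula density of (X, Y)
   is c" means equality almost everywhere on the open unit square for some
   version of the joint density. *)
Definition has_copula_density X Y (c : R -> R -> R) : Prop :=
  exists2 f : R * R -> R, is_joint_density X Y f &
    {ae (lebesgue_measure \x lebesgue_measure)%E, forall w : R * R,
      unit_square w -> copula_density X Y f w.1 w.2 = c w.1 w.2}.

(* g is a version of x |-> Pr(E | X = x). *)
Definition is_cond_prob X (E : set T) (g : R -> R) : Prop :=
  (distribution P X).-integrable [set: R] (EFin \o g) /\
  forall A : set R, measurable A ->
    P (X @^-1` A `&` E) = (\int[distribution P X]_(x in A) (g x)%:E)%E.

End LPBasis.

(* Main.v *)
Require Import Defs.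
From HB Require Import structures.
From mathcomp Require Import all_boot all_order all_algebra.
From mathcomp Require Import all_classical all_reals all_analysis.
From mathcomp Require Import measurable_realfun ring lra.
Import Order.TTheory GRing.Theory Num.Theory.
Import numFieldNormedType.Exports.
Local Open Scope classical_set_scope.
Local Open Scope ring_scope.

(** The Lebesgue measure on ]0, 1[ is mapped to the law of X by the quantile
    function of X, so a Borel set A is null for the law of X as soon as the
    rectangle Q_X^-1(A) * V is null for some V in ]0, 1[ of positive measure.
    Taking for V an interval on which Q_Y is constant, equal to y = 0 or 1,
    turns the model, an identity for almost every (u, v), into
      Pr(Y = y | X = x) / Pr(Y = y) = Z^-1 exp (s(x) T_1(y)),
      where s(x) = sum_j theta_j T_j(x),
    for almost every x. Dividing the identities for y = 1 and y = 0 cancels Z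
    and leaves the exponent s(x) (T_1(1) - T_1(0)) = s(x) / sqrt(mu (1 - mu)). *)

(** * Quantile functions and the transport of Lebesgue measure to the law of X *)

(** The set defining [quantile X u] is non-empty and bounded below because the distribution function
    F tends to 1 and 0 at the two ends and u lies strictly between; right-continuity then makes the
    infimum Q(u) a member of the set. *)
Lemma le_quantile (d : measure_display) (T : measurableType d) (R : realType)
    (P : probability T R) (X : {RV P >-> R}) (u x : R) :
  0 < u < 1 -> (quantile X u <= x) = (u%:E <= cdf X x)%E.
Proof.
move=> /andP[u0 u1].
have S0 : [set z | (u%:E <= cdf X z)%E] !=set0.
  have : \forall z \near +oo, (u%:E < cdf X z)%E.
    apply: (@cvg_cdfy1 _ _ _ _ X [set y | (u%:E < y)%E]).
    apply: open_nbhs_nbhs; split; first exact: open_ereal_gt_ereal.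
    by rewrite /= lte_fin.
  by move=> /filter_ex[z /ltW uz]; exists z.
have Sb : has_lbound [set z | (u%:E <= cdf X z)%E].
  have : \forall z \near -oo, (cdf X z < u%:E)%E.
    apply: (@cvg_cdfNy0 _ _ _ _ X [set y | (y < u%:E)%E]).
    apply: open_nbhs_nbhs; split; first exact: open_ereal_lt_ereal.
    by rewrite /= lte_fin.
  move=> /filter_ex[z zu]; exists z => y /= uy.
  rewrite leNgt; apply/negP => yz.
  have := lt_le_trans zu uy.
  by rewrite ltNge (cdf_nondecreasing X)// ltW.
apply/idP/idP => [qx|]; last exact: ge_inf.
apply: (@le_trans _ _ (cdf X (quantile X u))); last exact: cdf_nondecreasing.
(* If F(Q(u)) < u, right-continuity keeps F below u just to the right of Q(u), where the infimum
   property provides a point y with u <= F(y). *)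
rewrite leNgt; apply/negP => Fu.
have : \forall y \near (quantile X u)^'+, (cdf X y < u%:E)%E.
  apply: (@cdf_right_continuous _ _ _ _ X _ [set y | (y < u%:E)%E]).
  apply: open_nbhs_nbhs; split => //.
  exact: open_ereal_lt_ereal.
rewrite /at_right near_withinE => /nbhs_ballP[e /= e0 He].
have [y /= uy yq] := inf_adherent e0 (conj S0 Sb).
have qy : quantile X u <= y by exact: ge_inf.
have : (cdf X y < u%:E)%E.
  apply: He.
    by rewrite /ball/= distrC ger0_norm ?subr_ge0// ltrBlDl.
  rewrite lt_neqAle qy andbT; apply/eqP => qyE.
  by move: Fu; rewrite qyE ltNge uy.
by rewrite ltNge uy.
Qed.

(** By [le_quantile], the preimage in ]0, 1[ of a ray ]x, +oo[ consists of the u above F(x), hence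
    is an interval. *)
Lemma measurable_quantile (d : measure_display) (T : measurableType d)
    (R : realType) (P : probability T R) (X : {RV P >-> R}) :
  measurable_fun (`]0, 1[%classic : set R) (quantile X).
Proof.
move=> mD; apply: (measurability (@RGenOInfty.G R)) => //.
  exact: RGenOInfty.measurableE.
move=> _ [_ [x ->] <-]; apply: is_interval_measurable => s t /=.
rewrite !in_itv/= !andbT => -[/andP[s0 s1] xs] [/andP[t0 t1] xt] z /andP[sz zt].
have z0 : 0 < z by exact: lt_le_trans sz.
have z1 : z < 1 by exact: le_lt_trans t1.
rewrite in_itv/= z0 z1; split => //.
move: xs; rewrite /= !in_itv/= !andbT 2!ltNge.
rewrite le_quantile ?s0 ?s1// le_quantile ?z0 ?z1//.
by apply: contra; apply: le_trans; rewrite lee_fin.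
Qed.

(** The intervals ]a, b] form a generating class stable under intersection, and each is a difference
    of two rays. Finiteness of [m1] allows the subtraction; that of [m2] on rays is inherited from
    the equality. *)
Lemma measure_unique_itvNyc (R : realType)
    (m1 : {finite_measure set R -> \bar R})
    (m2 : {measure set R -> \bar R}) :
  (forall x : R, m1 `]-oo, x]%classic = m2 `]-oo, x]%classic) ->
  forall A, measurable A -> m1 A = m2 A.
Proof.
move=> m12 A mA; apply: (@measure_unique _ R _ (@ocitv R)
    (fun k => `](- k%:R : R), k%:R]%classic) _ _ _ _ m1 m2 _ _ A mA) => //.
- exact: ocitvI.
- by move=> k; exact: is_ocitv.
- exact: (@bigcup_itvT R false false).
- move=> _ [[a b] /= _ <-].
  have [ab|ba] := leP a b; last first.
    by rewrite set_itv_ge ?measure0// bnd_simp -leNgt ltW.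
  have -> : `]a, b]%classic = `]-oo, b] `\` `]-oo, a].
    by rewrite -[RHS]setCK setCD setCitvl setUC -[LHS]setCK setCitv.
  have ba : `]-oo, a] `<=` `]-oo, b]%classic by exact: subset_itvl.
  have m1b : (m1 `]-oo, b]%classic < +oo)%E.
    by rewrite -ge0_fin_numE ?fin_num_measure.
  rewrite !measureD ?(setIidr ba)//.
    by congr (_ - _)%E; exact: m12.
  by move: m1b; rewrite m12.
- by move=> k; rewrite -ge0_fin_numE ?fin_num_measure.
Qed.

(** Both sides are measures in A, and by [le_quantile] the preimage of ]-oo, x] is the part of ]0,
    F(x)] inside ]0, 1[, of length F(x). *)
Lemma lebesgue_preimage_quantile (d : measure_display) (T : measurableType d)
    (R : realType) (P : probability T R) (X : {RV P >-> R}) (A : set R) :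
  measurable A ->
  lebesgue_measure (`]0, 1[%classic `&` quantile X @^-1` A) = distribution P X A.
Proof.
move=> mA.
have m01 : measurable (`]0, 1[%classic : set R) by exact: measurable_itv.
(* Extending by 0 outside ]0, 1[ gives a function measurable on the whole line; restricting Lebesgue
   measure to ]0, 1[ discards the added values. *)
have mq : measurable_fun [set: R] (quantile X \_ (`]0, 1[%classic : set R)).
  by apply/(measurable_restrictT _ m01); exact: measurable_quantile.
(* [mkm] abstracts the measurability proof required by [pushforward]. *)
pose mkm : measure _ R :=
  pushforward (mrestr (@lebesgue_measure R) m01)
    (quantile X \_ (`]0, 1[%classic : set R)).
pose m := mkm mq.
have mE B : m B = lebesgue_measure (`]0, 1[%classic `&` quantile X @^-1` B).
  rewrite /m /= /pushforward /mrestr; congr (lebesgue_measure _).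
  apply/seteqP; split => u /=; rewrite patchE.
    by move=> [+ u01]; rewrite mem_set.
  by move=> [u01]; rewrite mem_set.
rewrite -mE; apply/esym.
apply: (measure_unique_itvNyc R (distribution P X) m _ A mA) => x.
rewrite mE -[LHS]/(cdf X x).
have F0 := cdf_ge0 X x; have F1 := cdf_le1 X x.
have Ff : cdf X x \is a fin_num by exact: fin_num_measure.
rewrite -(fineK Ff) in F0 F1 *; rewrite !lee_fin in F0 F1.
set p := fine _ in F0 F1 *.
have QE : `]0, 1[%classic `&` quantile X @^-1` `]-oo, x] =
    `]0, 1[%classic `&` `]0, p]%classic.
  apply/seteqP; split => u /=; rewrite !in_itv/= => -[u01].
    by rewrite le_quantile// -(fineK Ff) lee_fin => ->; case/andP: u01 => ->.
  by rewrite le_quantile// -(fineK Ff) lee_fin => /andP[].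
(* At p = 1 the intersection is the open ]0, 1[ rather than ]0, p], so this case is separate. *)
rewrite QE; have [p1|p1] := eqVneq p 1.
  have -> : `]0, 1[%classic `&` `]0, p]%classic = (`]0, 1[%classic : set R).
    apply/setIidl => u /=; rewrite p1 !in_itv/=.
    by move=> /andP[-> /ltW].
  by rewrite lebesgue_measure_itv/= lte_fin ltr01 p1 oppr0 addr0.
have -> : `]0, 1[%classic `&` `]0, p]%classic = (`]0, p]%classic : set R).
  apply/setIidr => u /=; rewrite !in_itv/= => /andP[-> /le_lt_trans]; apply.
  by rewrite lt_neqAle p1.
rewrite lebesgue_measure_itv/= lte_fin oppr0 adde0.
by case: ltP => // p0; congr EFin; apply: le_anti; rewrite p0 F0.
Qed.

(** * Measurability of the LP-basis *)

Lemma measurable_LP_T1 (d : measure_display) (T : measurableType d)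
    (R : realType) (P : probability T R) (X : {RV P >-> R}) :
  measurable_fun [set: R] (LP_T1 X).
Proof.
apply: measurable_funM; last exact: measurable_cst.
apply: measurable_funM; first exact: measurable_cst.
apply: measurable_funB; last exact: measurable_cst.
apply: measurable_funB.
  apply: measurableT_comp; last exact: cdf_measurable.
  exact: fine_measurable.
apply: measurable_funM; first exact: measurable_cst.
exact: pmf_measurable.
Qed.

(** Inner products and the norm are constants in x. The hypothesis runs over all indices of [nth];
    beyond the end it concerns the default [fun=> 1], which is measurable. *)
Lemma measurable_gram_schmidt_step (d : measure_display) (T : measurableType d)
    (R : realType) (P : probability T R) (X : {RV P >-> R})
    (s : seq (R -> R)) (f : R -> R) :
  (forall i, measurable_fun [set: R] (nth (fun=> 1) s i)) ->
  measurable_fun [set: R] f ->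
  measurable_fun [set: R] (gram_schmidt_step X s f).
Proof.
move=> ms mf; apply: measurable_funM; last exact: measurable_cst.
apply: measurable_funB => //.
under eq_fun do rewrite (big_nth (fun=> 1)).
by apply: measurable_sum => i; apply: measurable_funM; first exact: measurable_cst.
Qed.

Lemma measurable_LP_family (d : measure_display) (T : measurableType d)
    (R : realType) (P : probability T R) (X : {RV P >-> R}) (n i : nat) :
  measurable_fun [set: R] (nth (fun=> 1) (LP_family X n) i).
Proof.
elim: n i => [|n IHn] i /=; first by case: i => [|[|i]]; exact: measurable_cst.
rewrite nth_rcons; case: ifP => // _; case: ifP => // _; case: n IHn => [|n] IHn.
  exact: measurable_LP_T1.
apply: measurable_gram_schmidt_step => //.
by apply: measurable_funX; exact: measurable_LP_T1.
Qed.

(** Serves to show that the set of x where density and model disagree is Borel. *)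
Lemma measurable_LP_T (d : measure_display) (T : measurableType d)
    (R : realType) (P : probability T R) (X : {RV P >-> R}) (j : nat) :
  measurable_fun [set: R] (LP_T X j).
Proof. by rewrite /LP_T -nth_last; exact: measurable_LP_family. Qed.

(** * Law, quantile function and first LP function of a binary variable *)

Lemma preimage_binary0 (T : Type) (R : realType) (Y : T -> R) :
  (forall w, Y w = 0 \/ Y w = 1) ->
  Y @^-1` [set 0] = ~` (Y @^-1` [set 1]).
Proof.
move=> Y01; apply/seteqP; split => w /=; last by case: (Y01 w).
by move=> ->; apply/eqP; rewrite eq_sym oner_eq0.
Qed.

Lemma pmf_binary (d : measure_display) (T : measurableType d)
    (R : realType) (P : probability T R) (Y : {RV P >-> R}) (mu : R) :
  (forall w, Y w = 0 \/ Y w = 1) -> P (Y @^-1` [set 1]) = mu%:E ->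
  P (Y @^-1` [set 0]) = (1 - mu)%:E.
Proof.
move=> Y01 Pmu.
have mY1 : measurable (Y @^-1` [set 1]).
  by apply: measurable_funPTI; exact: measurable_set1.
by rewrite preimage_binary0// probability_setC ?Pmu.
Qed.

Lemma cdf_binary (d : measure_display) (T : measurableType d)
    (R : realType) (P : probability T R) (Y : {RV P >-> R}) (mu x : R) :
  (forall w, Y w = 0 \/ Y w = 1) -> P (Y @^-1` [set 1]) = mu%:E ->
  cdf Y x = (if x < 0 then 0 else if x < 1 then 1 - mu else 1)%:E.
Proof.
move=> Y01 Pmu; rewrite /cdf /distribution /pushforward.
case: ltP => x0.
  rewrite (_ : _ @^-1` _ = set0) ?measure0//; apply/seteqP; split => w //=.
  by rewrite in_itv/=; case: (Y01 w) => ->; lra.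
case: ltP => x1.
  rewrite -(pmf_binary _ _ _ _ _ _ Y01 Pmu); congr (P _).
  by apply/seteqP; split => w /=; rewrite in_itv/=; case: (Y01 w) => ->; lra.
rewrite (_ : _ @^-1` _ = setT) ?probability_setT//; apply/seteqP; split => w //= _.
by rewrite in_itv/=; case: (Y01 w) => ->; lra.
Qed.

Lemma quantile_binary0 (d : measure_display) (T : measurableType d)
    (R : realType) (P : probability T R) (Y : {RV P >-> R}) (mu v : R) :
  (forall w, Y w = 0 \/ Y w = 1) -> P (Y @^-1` [set 1]) = mu%:E ->
  0 < v < 1 -> v <= 1 - mu -> quantile Y v = 0.
Proof.
move=> Y01 Pmu v01 vmu; apply/le_anti/andP; split.
  by rewrite le_quantile// (cdf_binary _ _ _ _ _ mu)// ltxx ltr01 lee_fin.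
rewrite leNgt; apply/negP => q0.
(* Through [le_quantile], reflexivity reads v <= F(Q(v)), whereas F vanishes to the left of 0. *)
have := lexx (quantile Y v).
by rewrite {1}le_quantile// (cdf_binary _ _ _ _ _ mu)// q0 lee_fin; lra.
Qed.

Lemma quantile_binary1 (d : measure_display) (T : measurableType d)
    (R : realType) (P : probability T R) (Y : {RV P >-> R}) (mu v : R) :
  (forall w, Y w = 0 \/ Y w = 1) -> P (Y @^-1` [set 1]) = mu%:E ->
  0 < v < 1 -> 1 - mu < v -> quantile Y v = 1.
Proof.
move=> Y01 Pmu v01 vmu; apply/le_anti/andP; split.
  by rewrite le_quantile// (cdf_binary _ _ _ _ _ mu)// ltxx ltr10 lee_fin; lra.
rewrite leNgt; apply/negP => q1.
have := lexx (quantile Y v).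
by rewrite {1}le_quantile// (cdf_binary _ _ _ _ _ mu)// q1 lee_fin; case: ifP; lra.
Qed.

Lemma esum_pmf3_binary (d : measure_display) (T : measurableType d)
    (R : realType) (P : probability T R) (Y : {RV P >-> R}) (mu : R) :
  (forall w, Y w = 0 \/ Y w = 1) -> P (Y @^-1` [set 1]) = mu%:E ->
  (\esum_(a in [set: R]) (pmf Y a ^+ 3)%:E)%E = (mu ^+ 3 + (1 - mu) ^+ 3)%:E.
Proof.
move=> Y01 Pmu.
have p1 : pmf Y 1 = mu by rewrite /pmf Pmu.
have p0 : pmf Y 0 = 1 - mu by rewrite /pmf (pmf_binary _ _ _ _ _ mu).
pose D : set R := [set 1; 0].
have pE a : a \notin D -> pmf Y a = 0.
  rewrite notin_setE => a01; rewrite /pmf (_ : _ @^-1` _ = set0) ?measure0//.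
  apply/seteqP; split => w //= wa; apply: a01; rewrite -wa.
  by case: (Y01 w) => ->; [right|left].
transitivity (\esum_(a in D) (pmf Y a ^+ 3)%:E)%E.
  rewrite [RHS]esum_mkcond; apply: eq_esum => a _.
  by case: ifPn => // /pE ->; rewrite expr0n.
rewrite esum_fset//=; last 2 first.
- by rewrite /D.
- by move=> i _; rewrite lee_fin exprn_ge0// pmf_ge0.
rewrite /D fsbigU0//=; last by move=> x [-> /eqP]; rewrite oner_eq0.
by rewrite !fsbig_set1 p1 p0.
Qed.

(** Since 1 - mu^3 - (1 - mu)^3 = 3 mu (1 - mu), the normalizing factor is 2 / sqrt (mu (1 - mu)),
    and its 2 cancels the half in Fmid(y) - 1/2 = (y - mu) / 2. *)
Lemma LP_T1_binary (d : measure_display) (T : measurableType d)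
    (R : realType) (P : probability T R) (Y : {RV P >-> R}) (mu y : R) :
  (forall w, Y w = 0 \/ Y w = 1) -> P (Y @^-1` [set 1]) = mu%:E ->
  0 < mu < 1 -> y = 0 \/ y = 1 ->
  LP_T1 Y y = (y - mu) / Num.sqrt (mu * (1 - mu)).
Proof.
move=> Y01 Pmu /andP[mu0 mu1] y01.
have FE : Fmid Y y - 2^-1 = (y - mu) / 2.
  rewrite /Fmid (cdf_binary _ _ _ _ _ mu)//=.
  case: y01 => ->.
    by rewrite /pmf (pmf_binary _ _ _ _ _ mu)//= ltxx ltr01; field.
  by rewrite /pmf Pmu /= ltxx ltr10; field.
have s0 : 0 < mu * (1 - mu) by rewrite mulr_gt0// subr_gt0.
rewrite /LP_T1 FE (esum_pmf3_binary _ _ _ _ _ mu)//=.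
rewrite (_ : 1 - _ = 3 * (mu * (1 - mu))); last by ring.
rewrite (_ : 12 = 2 ^+ 2 * 3); last by ring.
rewrite sqrtrM ?sqr_ge0// sqrtr_sqr ger0_norm ?ler0n//.
rewrite (sqrtrM (mu * (1 - mu))) ?ler0n//.
have t0 : Num.sqrt (mu * (1 - mu)) != 0 by rewrite sqrtr_eq0 -ltNge.
have r0 : Num.sqrt (3 : R) != 0 by rewrite sqrtr_eq0 -ltNge ltr0n.
by field; rewrite r0 t0.
Qed.

(** * Conditional probabilities and the joint density *)

(** Both functions have the same integral over every Borel set E, namely the joint law of E x {y}:
    by Tonelli, the inner integral of f(x, .) over {y} is f(x, y) Pr(Y = y). *)
Lemma cond_prob_joint_density (d : measure_display) (T : measurableType d)
    (R : realType) (P : probability T R) (X Y : {RV P >-> R})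
    (f : R * R -> R) (g : R -> R) (y p : R) :
  is_joint_density X Y f -> is_cond_prob X (Y @^-1` [set y]) g ->
  P (Y @^-1` [set y]) = p%:E ->
  {ae distribution P X, forall x, g x = f (x, y) * p}.
Proof.
move=> [mf f0 fE] [ig gE] Pp.
have p0 : 0 <= p by rewrite -lee_fin -Pp.
have mfy : measurable_fun [set: R] (fun x => f (x, y)).
  by apply: measurableT_comp => //; exact: measurable_pair2.
have my : measurable [set y] by exact: measurable_set1.
suff : ae_eq (distribution P X) setT (EFin \o g) (fun x => (f (x, y) * p)%:E).
  by apply: filterS => x /(_ I) [].
apply: integral_ae_eq => //.
  by apply/measurable_EFinP; apply: measurable_funM => //; exact: measurable_cst.
move=> E _ mE; rewrite -gE//.
have -> : X @^-1` E `&` Y @^-1` [set y] = [set w | (E `*` [set y]) (X w, Y w)] by [].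
have mEy : measurable (E `*` [set y]) by exact: measurableX.
rewrite fE// [LHS]integral_mkcond.
rewrite (@fubini_tonelli1 _ _ _ _ _ (distribution P X) (distribution P Y)); last 2 first.
- apply/(measurable_restrictT _ mEy); apply/measurable_EFinP.
  exact: measurable_funTS.
- by apply: erestrict_ge0 => z _; rewrite lee_fin.
rewrite [RHS]integral_mkcond; apply: eq_integral => x _.
rewrite /fubini_F patchE; case: ifPn => xE.
  rewrite EFinM -Pp -[X in (_ * X)%E]/(distribution P Y [set y]) -integral_cst//.
  rewrite [RHS]integral_mkcond; apply: eq_integral => z _.
  rewrite !patchE in_setX xE /=; case: ifPn => //.
  by rewrite inE => ->.
by apply: integral0_eq => z _; rewrite patchE in_setX (negbTE xE).
Qed.

(** Provides a version of Pr(Y = 0 | X = x) from one of Pr(Y = 1 | X = x). *)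
Lemma is_cond_prob_setC (d : measure_display) (T : measurableType d)
    (R : realType) (P : probability T R) (X : {RV P >-> R})
    (E : set T) (g : R -> R) :
  measurable E -> is_cond_prob X E g ->
  is_cond_prob X (~` E) (fun x => 1 - g x).
Proof.
move=> mE [ig gE].
have i1 : (distribution P X).-integrable setT (EFin \o cst (1 : R)).
  by apply: finite_measure_integrable_cst.
have i1g : (distribution P X).-integrable [set: R] (EFin \o (fun x => 1 - g x)).
  exact: (integrableB measurableT i1 ig).
split => // A mA.
have mXA : measurable (X @^-1` A) by exact: measurable_funPTI.
transitivity (P (X @^-1` A) - P (X @^-1` A `&` E))%E.
  by rewrite -setDE measureD// -ge0_fin_numE ?fin_num_measure.
rewrite gE//.
have := integralB mA (integrableS measurableT mA (@subsetT _ A) i1)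
  (integrableS measurableT mA (@subsetT _ A) ig).
rewrite [X in (_ = X - _)%E -> _](_ : _ = P (X @^-1` A)) => [->//|].
by rewrite -[RHS]mul1e; exact: (integral_cst (distribution P X) mA 1%E).
Qed.

(** * From almost every (u, v) to almost every x *)

(** With B the preimage of A under the quantile function, B x V lies in the exceptional null set, so
    the product of the lengths of B and V is 0; V has positive length, hence B is null. *)
Lemma distribution_null_square (d : measure_display) (T : measurableType d)
    (R : realType) (P : probability T R) (X : {RV P >-> R}) (A V : set R) :
  measurable A -> measurable V -> V `<=` `]0, 1[ ->
  lebesgue_measure V <> 0%E ->
  {ae (lebesgue_measure \x lebesgue_measure)%E, forall w : R * R,
    unit_square w -> V w.2 -> ~ A (quantile X w.1)} ->
  distribution P X A = 0%E.
Proof.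
move=> mA mV V01 V0 [N [mN N0 HN]].
rewrite -lebesgue_preimage_quantile//.
set B := _ `&` _.
have mB : measurable B by apply: measurable_quantile.
have : (lebesgue_measure \x lebesgue_measure)%E (B `*` V) = 0%E.
  apply: subset_measure0 N0 => //; first exact: measurableX.
  move=> [u v] [/= [u01 Au] Vv]; apply: HN => /=; apply/not_implyP; split.
    by split => //=; exact: V01.
  by move=> /(_ Vv); exact.
rewrite product_measure1E//.
by move/eqP; rewrite mule_eq0 => /orP[|] /eqP.
Qed.

Lemma cvgn_sumMr (R : realType) (a : nat -> R) (c : R) :
  cvgn (fun n => \sum_(1 <= j < n) a j) ->
  (fun n => \sum_(1 <= j < n) a j * c) @ \oo -->
    (\big[+%R/0]_(1 <= j <oo) a j) * c.
Proof.
move=> ca; under eq_fun do rewrite -mulr_suml.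
exact: cvgM ca (cvg_cst c).
Qed.

(** [LP_T Y 1] computes to [LP_T1 Y], whose value does not depend on j and factors out of the limit;
    convergence is what makes the limit of the products the product of the limit. *)
Lemma LP_exponentE (d : measure_display) (T : measurableType d) (R : realType)
    (P : probability T R) (X Y : {RV P >-> R}) (theta : nat -> R) (u v : R) :
  cvgn (fun n => \sum_(1 <= j < n) theta j * LP_T X j (quantile X u)) ->
  LP_exponent X Y theta u v =
  (\big[+%R/0]_(1 <= j <oo) (theta j * LP_T X j (quantile X u))) *
  LP_T1 Y (quantile Y v).
Proof. by move=> cv; apply: cvg_lim => //; exact: cvgn_sumMr. Qed.

Lemma joint_density_LP_model (d : measure_display) (T : measurableType d)
    (R : realType) (P : probability T R) (X Y : {RV P >-> R})
    (theta : nat -> R) (f : R * R -> R) (y : R) (V : set R) :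
  measurable V -> V `<=` `]0, 1[ -> lebesgue_measure V <> 0%E ->
  (forall v, V v -> quantile Y v = y) ->
  measurable_fun [set: R * R] f ->
  {ae distribution P X, forall x : R,
    cvgn (fun n => \sum_(1 <= j < n) theta j * LP_T X j x)} ->
  {ae (lebesgue_measure \x lebesgue_measure)%E, forall w : R * R,
    unit_square w ->
    copula_density X Y f w.1 w.2 = LP_model X Y theta w.1 w.2} ->
  {ae distribution P X, forall x, f (x, y) = (fine (LP_Z X Y theta))^-1 *
    expR ((\big[+%R/0]_(1 <= j <oo) (theta j * LP_T X j x)) * LP_T1 Y y)}.
Proof.
(* [N] is a Borel null set containing every x where the series diverges; as a pointwise limit, the
   sum is shown measurable on its complement. *)
move=> mV V01 V0 Vy mf [N [mN N0 HN]] model.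
have Ncv x : ~ N x -> cvgn (fun n => \sum_(1 <= j < n) theta j * LP_T X j x).
  by move=> Nx; apply: contrapT => /HN.
have mCN : measurable (~` N) by exact: measurableC.
pose s x := \big[+%R/0]_(1 <= j <oo) (theta j * LP_T X j x).
pose h x := (fine (LP_Z X Y theta))^-1 * expR (s x * LP_T1 Y y).
have ms : measurable_fun (~` N) s.
  apply: (measurable_fun_cvg (h := fun n x => \sum_(1 <= j < n) theta j * LP_T X j x)).
    move=> n; apply: measurable_sum => j; apply: measurable_funM.
      exact: measurable_cst.
    by apply: measurable_funTS; exact: measurable_LP_T.
  by move=> x /Ncv.
have mh : measurable_fun (~` N) h.
  apply: measurable_funM; first exact: measurable_cst.
  apply: measurableT_comp => //.
  by apply: measurable_funM => //; exact: measurable_cst.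
have mfy : measurable_fun (~` N) (fun x => f (x, y)).
  by apply: measurable_funTS; apply: measurableT_comp => //; exact: measurable_pair2.
(* The exceptional set splits into [N] and the part [A] outside it, which is Borel and so within
   reach of [distribution_null_square]. *)
pose A := ~` N `&` [set x | (f (x, y))%:E != (h x)%:E].
have mA : measurable A by apply: measurable_neqe => //; exact/measurable_EFinP.
have A0 : distribution P X A = 0%E.
  apply: distribution_null_square mA mV V01 V0 _.
  apply: negligibleS model => w /=; apply: contra_not => wE w01 Vw [Nw /eqP]; apply.
  move: (wE w01); rewrite /copula_density (Vy _ Vw) => ->.
  by rewrite /LP_model LP_exponentE ?(Vy _ Vw)//; exact: Ncv.
apply: (@negligibleS _ _ _ _ (N `|` A)); last first.
  by apply: negligibleU; apply/negligibleP.
move=> x /= fx; have [Nx|Nx] := pselect (N x); [by left|right; split => //=].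
by apply/eqP => -[].
Qed.

(** * The log-odds at almost every x *)

Theorem theorem5 (d : measure_display) (T : measurableType d) (R : realType)
    (P : probability T R) (X Y : {RV P >-> R})
    (mu : R) (mux : R -> R) (theta : nat -> R)
    (X_nondegenerate : nondegenerate_rv X)
    (X_discrete_or_continuous : discrete_rv X \/ continuous_rv X)
    (Y_binary : forall w, Y w = 0 \/ Y w = 1)
    (mu_def : P (Y @^-1` [set 1]) = mu%:E)
    (mu_01 : 0 < mu < 1)
    (mux_def : is_cond_prob X (Y @^-1` [set 1]) mux)
    (theta_cvg : {ae distribution P X, forall x : R,
       cvgn (fun n => \sum_(1 <= j < n) theta j * LP_T X j x)})
    (Z_pos_finite : (0 < LP_Z X Y theta < +oo)%E)
    (model : has_copula_density X Y (LP_model X Y theta)) :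
  {ae distribution P X, forall x : R,
    let alpha0 := logit mu in
    let alpha := fun j : nat => theta j / Num.sqrt (mu * (1 - mu)) in
    [/\ 0 < mux x < 1,
        cvgn (fun n => \sum_(1 <= j < n) alpha j * LP_T X j x) &
        logit (mux x) =
          alpha0 + \big[+%R/0]_(1 <= j <oo) (alpha j * LP_T X j x)]}.
Proof.
have /andP[mu0 mu1] := mu_01.
have nmu0 : 0 < 1 - mu by rewrite subr_gt0.
have [f fd fmodel] := model.
have [mf _ _] := fd.
have mY1 : measurable (Y @^-1` [set 1]).
  by apply: measurable_funPTI; exact: measurable_set1.
have mux0_def : is_cond_prob X (Y @^-1` [set 0]) (fun x => 1 - mux x).
  by rewrite preimage_binary0//; exact: is_cond_prob_setC.
have mux1E := cond_prob_joint_density _ _ _ _ _ _ _ _ _ _ fd mux_def mu_def.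
have mux0E := cond_prob_joint_density _ _ _ _ _ _ _ _ _ _ fd mux0_def
  (pmf_binary _ _ _ _ _ _ Y_binary mu_def).
have f0E : {ae distribution P X, forall x, f (x, 0) = (fine (LP_Z X Y theta))^-1 *
    expR ((\big[+%R/0]_(1 <= j <oo) (theta j * LP_T X j x)) * LP_T1 Y 0)}.
  (* On ]0, 1 - mu[, of length Pr(Y = 0), the quantile function of Y is 0; on ]1 - mu, 1[, used
     next, it is 1. *)
  apply: (joint_density_LP_model _ _ _ _ _ _ _ _ _ `]0, 1 - mu[) => //.
  - move=> v /=; rewrite !in_itv/= => /andP[-> /lt_trans]; apply.
    by rewrite ltrBlDr ltrDl.
  - rewrite lebesgue_measure_itv/= lte_fin nmu0 oppr0 adde0 => -[].
    by apply/eqP; rewrite gt_eqF.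
  - move=> v /=; rewrite in_itv/= => /andP[v0 v1].
    apply: (quantile_binary0 _ _ _ _ _ mu) => //; last exact: ltW.
    by rewrite v0 (lt_trans v1)// ltrBlDr ltrDl.
have f1E : {ae distribution P X, forall x, f (x, 1) = (fine (LP_Z X Y theta))^-1 *
    expR ((\big[+%R/0]_(1 <= j <oo) (theta j * LP_T X j x)) * LP_T1 Y 1)}.
  apply: (joint_density_LP_model _ _ _ _ _ _ _ _ _ `]1 - mu, 1[) => //.
  - by move=> v /=; rewrite !in_itv/= => /andP[/(lt_trans nmu0) ->].
  - rewrite lebesgue_measure_itv/= lte_fin ltrBlDr ltrDl mu0 -EFinB opprB.
    rewrite addrC subrK => -[].
    by apply/eqP; rewrite gt_eqF.
  - move=> v /=; rewrite in_itv/= => /andP[v0 v1].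
    apply: (quantile_binary1 _ _ _ _ _ mu) => //.
    by rewrite v1 (lt_trans nmu0).
have k0 : 0 < (fine (LP_Z X Y theta))^-1.
  by rewrite invr_gt0 fine_gt0.
rewrite (LP_T1_binary _ _ _ _ _ mu) // in f0E; last by left.
rewrite (LP_T1_binary _ _ _ _ _ mu) // in f1E; last by right.
have t0 : 0 < Num.sqrt (mu * (1 - mu)) by rewrite sqrtr_gt0 mulr_gt0.
move: (fine (LP_Z X Y theta))^-1 (Num.sqrt (mu * (1 - mu))) k0 t0 f0E f1E.
move=> k t k0 t0 f0E f1E.
near=> x => /=.
have cx : cvgn (fun n => \sum_(1 <= j < n) theta j * LP_T X j x) by near: x.
have m1 : mux x = f (x, 1) * mu by near: x.
have m0 : 1 - mux x = f (x, 0) * (1 - mu) by near: x.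
have f0x : f (x, 0) = k *
    expR ((\big[+%R/0]_(1 <= j <oo) (theta j * LP_T X j x)) * ((0 - mu) / t)).
  by near: x.
have f1x : f (x, 1) = k *
    expR ((\big[+%R/0]_(1 <= j <oo) (theta j * LP_T X j x)) * ((1 - mu) / t)).
  by near: x.
(* Dividing the series by t termwise turns theta_j into alpha_j, which gives both the convergence
   and the value of the final sum. *)
have := cvgn_sumMr _ _ t^-1 cx.
under eq_fun do under eq_bigr do rewrite mulrAC.
move=> cxt.
(* Both conditional probabilities are products of positive factors, so the odds and their logarithm
   are meaningful at x. *)
have mux_gt0 : 0 < mux x by rewrite m1 f1x !mulr_gt0// expR_gt0.
have mux_lt1 : 0 < 1 - mux x by rewrite m0 f0x !mulr_gt0// expR_gt0.
split.
- by rewrite mux_gt0 -subr_gt0.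
- by apply/cvg_ex; eexists; exact: cxt.
rewrite (cvg_lim _ cxt)//.
set s := \big[+%R/0]_(1 <= j <oo) _ in f0x f1x *.
(* The exponents for y = 1 and y = 0 differ by s / t, because (1 - mu) - (0 - mu) = 1. *)
have e : expR (s * ((1 - mu) / t)) = expR (s * ((0 - mu) / t)) * expR (s / t).
  by rewrite -expRD; congr expR; field; rewrite gt_eqF.
rewrite /logit (_ : mux x / _ = mu / (1 - mu) * expR (s / t)).
  by rewrite lnM ?expRK// posrE ?expR_gt0// divr_gt0.
(* Only the numerator is rewritten by [m1]; the denominator keeps the form [1 - mux x] that [m0]
   replaces. Then k and the common exponential cancel. *)
rewrite {1}m1 m0 f1x f0x e.
have := expR_gt0 (s * ((0 - mu) / t)); move: (expR _) => E E0.
by field; rewrite !gt_eqF.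
Unshelve. all: by end_near. Qed.
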